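(* There exists $k_0$ such that for every integer $k\ge k_0$, every bipartite outer $k$-planar graph $G$ on $n$ vertices has at most $2\sqrt{\frac{8}{11}}\sqrt{k}\,n$ edges (where $2\sqrt{\frac{8}{11}}\approx 1.7$).
   Context: A convex geometric graph is a drawing of a finite simple graph in the plane whose vertex set is a set of points in convex position (no three collinear) and whose edges are drawn as straight-line segments between their endpoints. Two edges cross if they share a point in their relative interiors. The drawing is $k$-plane if each edge crosses at most $k$ other edges. A graph is outer $k$-planar if it admits a convex geometric $k$-plane drawing. A bipartite outer $k$-planar graph is an outer $k$-planar graph that is bipartite; the two color classes may appear in any order along the convex hull. *)

(* Defs.v *)
From HB Require Import structures.
From mathcomp Require Import all_boot all_order all_algebra.
From mathcomp Require Import boolp classical_sets reals.

Set Implicit Arguments.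
Unset Strict Implicit.
Unset Printing Implicit Defensive.

Import Order.TTheory GRing.Theory Num.Theory.

Local Open Scope ring_scope.

Definition simple_graph (V : finType) (e : rel V) : Prop :=
  symmetric e /\ irreflexive e.

(* Undirected edges are unordered pairs of vertices, so each is counted once. *)
Definition edges (V : finType) (e : rel V) : {set {set V}} :=
  [set [set x; y] | x in V, y in V & e x y].

Definition bipartite (V : finType) (e : rel V) : Prop :=
  exists c : V -> bool, forall x y, e x y -> c x != c y.

Definition collinear (R : realType) (a b c : 'rV[R]_2) : Prop :=
  exists q d : 'rV[R]_2, d != 0 /\
    forall z, z \in [:: a; b; c] -> exists t : R, z = q + t *: d.

(* Convex hull of the points [p u] with [u \in A], as the set of their convex
   combinations. *)
Definition convex_hull (R : realType) (V : finType) (p : V -> 'rV[R]_2)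
    (A : {set V}) : set 'rV[R]_2 :=
  [set z | exists w : V -> R,
     [/\ forall u, 0 <= w u,
         \sum_(u in A) w u = 1
       & z = \sum_(u in A) w u *: p u]]%classic.

(* Every vertex is an extreme point of the point set.  The first two clauses
   follow from the last one. *)
Definition convex_position (R : realType) (V : finType) (p : V -> 'rV[R]_2) :
    Prop :=
  [/\ injective p,
      forall x y z, x != y -> y != z -> x != z -> ~ collinear (p x) (p y) (p z)
    & forall v, ~ convex_hull p [set~ v] (p v)].

Definition open_segment (R : realType) (V : finType) (p : V -> 'rV[R]_2)
    (f : {set V}) : set 'rV[R]_2 :=
  [set z | exists x y : V, exists t : R,
     [/\ f = [set x; y]%SET, 0 < t < 1 & z = (1 - t) *: p x + t *: p y]]%classic.

Definition cross (R : realType) (V : finType) (p : V -> 'rV[R]_2)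
    (f g : {set V}) : Prop :=
  exists z, open_segment p f z /\ open_segment p g z.

Definition k_plane (R : realType) (k : nat) (V : finType) (e : rel V)
    (p : V -> 'rV[R]_2) : Prop :=
  forall f, f \in edges e ->
    (#|[set g in edges e | (g != f) && `[< cross p f g >]]%SET| <= k)%N.

Definition outer_k_planar (R : realType) (k : nat) (V : finType) (e : rel V) :
    Prop :=
  exists p : V -> 'rV[R]_2, convex_position p /\ k_plane k e p.

(* Main.v *)
Require Import Defs.
From HB Require Import structures.
From mathcomp Require Import all_boot all_order all_algebra.
From mathcomp Require Import boolp classical_sets reals.
From mathcomp Require Import zify ring lra.

Set Implicit Arguments.
Unset Strict Implicit.
Unset Printing Implicit Defensive.

(** The bound is a minimum-degree argument.  Fix [T] with [2 * k < 3 * T ^ 2]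
    and suppose that there are more than [(2 * T + 1) * n] edges.  A subset [S]
    of the vertices, smallest among those that still span more than
    [(2 * T + 1) * #|S|] edges, induces a graph of minimum degree at least
    [2 * T + 2] ([dense_subgraph]).

    Number the vertices of [S] along the convex hull and take an edge [ab] with
    [b - a > T] for which [b - a] is least.  Every other edge between two
    vertices of the interval [[a, b]] then has length at most [T] and, by
    bipartiteness, endpoints of different colours.  Consequently a vertex [v]
    with [a < v < b] has at most
      [minn T (v - a) + minn T (b - v) - same v]
    neighbours in [[a, b]], where [same v] counts vertices near [v] of the
    colour of [v]; all its other edges cross [ab].  Relative to the degree
    [2 * T + 2], the truncation near the two ends of the interval contributes
    [T * (T - 1)] crossings in total, the two spare units of degree contribute
    [2 * T], and the first [T] inner vertices, which are pairwise within
    distance [T], contain at least [T ^ 2 / 2 - T] ordered pairs of distinct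
    vertices of the same colour.  Altogether [ab] is crossed at least
    [3 / 2 * T ^ 2 > k] times ([leaving_edges_ge], [heavily_crossed_edge]), a
    contradiction.

    Hence there are at most [(2 * T + 1) * n] edges ([edges_le]).  With the
    least admissible [T], which is about [sqrt (2 * k / 3)], the factor is about
    [2 * sqrt (2 / 3) * sqrt k]; since [2 / 3 < 8 / 11] the stated bound absorbs
    the lower-order terms as soon as [k] is large. *)

(* The names of the finite-set library take precedence over those of the
   classical sets. *)
Import mathcomp.boot.fintype mathcomp.boot.finset.
Import Order.TTheory GRing.Theory Num.Theory.

(** * Counting near pairs in an interval of integers *)

Lemma sum_near_left T a v :
  \sum_(a <= j < v) (v - j <= T : nat) = minn T (v - a).
Proof.
have [le_av|lt_va] := leqP a v; last by rewrite big_geq; lia.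
move: le_av => /subnK <-; move: (v - a) => d; elim: d T => [|d IHd] T.
  by rewrite big_geq; lia.
rewrite addSn big_nat_recl; last by lia.
under eq_bigr do rewrite subSS.
by rewrite IHd; lia.
Qed.

Lemma sum_near_right T v b :
  \sum_(v.+1 <= j < b.+1) (j - v <= T : nat) = minn T (b - v).
Proof.
have [le_vb|lt_bv] := leqP v b; last by rewrite big_geq; lia.
move: le_vb => /subnK <-; elim: (b - v) => [|d IHd].
  by rewrite big_geq; lia.
rewrite big_nat_recr /=; last by lia.
by rewrite IHd; lia.
Qed.

(** A vertex at distance [i] from an end of an interval has [minn T i]
    positions within distance [T] on that side.  Compared with the value [T] in
    the middle, the truncation costs [T * (T - 1) / 2], whatever the length of
    the interval. *)
Lemma sum_minn T m : T <= m ->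
  2 * (\sum_(1 <= i < m.+1) minn T i) + T * T.-1 = 2 * (T * m).
Proof.
move=> /subnK <-; elim: (m - T) => [|d IHd]; last first.
  rewrite addSn big_nat_recr //=; nia.
rewrite add0n (_ : (\sum_(1 <= i < _) _)%N = \sum_(1 <= i < T.+1) i); last first.
  by apply: eq_big_nat => i; lia.
elim: T => [|T IHT]; first by rewrite big_geq.
rewrite big_nat_recr //=; nia.
Qed.

(** Two classes of sizes [r] and [s] give [r ^ 2 + s ^ 2 >= (r + s) ^ 2 / 2]
    ordered pairs of equal colour. *)
Lemma sum_same_color (c : nat -> bool) m T :
  T ^ 2 <= 2 * \sum_(m <= v < m + T) \sum_(m <= j < m + T) (c j == c v : nat).
Proof.
pose r := \sum_(m <= j < m + T) (c j : nat).
pose s := \sum_(m <= j < m + T) (~~ c j : nat).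
have rsT : r + s = T.
  rewrite -big_split /= (eq_bigr (fun=> 1)) => [|j _]; last by case: (c j).
  by rewrite sum_nat_const_nat muln1; lia.
rewrite (_ : (\sum_(m <= v < _) _)%N = r * r + s * s); last first.
  rewrite {1}/r {2}/s !big_distrl -big_split /=; apply: eq_bigr => v _.
  rewrite /r /s !big_distrr -big_split /=; apply: eq_bigr => j _.
  by case: (c j); case: (c v).
by rewrite -rsT -mulnn; have := (nat_Cauchy r s).1; rewrite -!mulnn; clear; nia.
Qed.

(** * The shortest long edge of a bipartite graph on an interval *)

Section ShortestLongEdge.

Variables (n T : nat) (g : rel nat) (c : nat -> bool).
Hypothesis g_sym : symmetric g.
Hypothesis g_col : forall i j, g i j -> c i != c j.

(** An edge longer than [T] exists because vertex [0] has only [T] positions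
    within distance [T], all of them on its right. *)
Lemma exists_shortest_long_edge :
  (forall i j, g i j -> i < n) -> 0 < n -> T < \sum_(0 <= j < n) g 0 j ->
  exists a b, [/\ g a b, a + T < b, b < n &
    forall i j, g i j -> a <= i < j -> j <= b -> T < j - i -> i = a /\ j = b].
Proof.
move=> g_lt n_gt0 degT.
have [j0 [j0n gj0 Tj0]] : exists j, [/\ j < n, g 0 j & T < j].
  case: (pickP (fun j : 'I_n => g 0 j && (T < j))) => [j /andP[? ?]|none].
    by exists j.
  suff : \sum_(0 <= j < n) g 0 j <= T by lia.
  have g00 : g 0 0 = false by apply: contraTF isT => /g_col; rewrite eqxx.
  have := sum_near_right T 0 n.-1; rewrite prednK // subn0 => sumE.
  rewrite big_ltn // g00 add0n; apply: leq_trans (geq_minl T n.-1).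
  rewrite -sumE big_nat_cond [leqRHS]big_nat_cond; apply: leq_sum => j.
  rewrite andbT => /andP[_ jn]; have := none (Ordinal jn) => /=.
  by case: (g 0 j) => //= /negbT; lia.
pose P (x : 'I_n * 'I_n) := g x.1 x.2 && (x.1 + T < x.2).
have P0 : P (Ordinal n_gt0, Ordinal j0n) by rewrite /P /= gj0.
case: (@arg_minnP _ _ P (fun x => x.2 - x.1) P0).
move=> [a b] /= /andP[/= gab Tab] minab.
exists a, b; split=> // i j gij /andP[ai ij] jb Tij.
have iN := g_lt _ _ gij; have jN : j < n by apply: (g_lt j i); rewrite g_sym.
have := minab (Ordinal iN, Ordinal jN); rewrite /P /= gij /=.
by move=> /(_ ltac:(lia)); lia.
Qed.

Variables a b : nat.
Hypotheses (abT : a + T < b) (bn : b < n).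
Hypothesis short : forall i j, g i j -> a <= i < j -> j <= b -> T < j - i ->
  i = a /\ j = b.

(* Only the first [T] inner vertices are compared: they are pairwise within
   distance [T], and already supply enough pairs of equal colour. *)
Let same v := \sum_(a <= j < b.+1)
  [&& v <= a + T, a < j <= a + T, j != v & c j == c v] : nat.

(** By minimality of [ab], the neighbours of [v] in [[a, b]] are among the
    positions at distance at most [T], and the positions counted by [same v]
    are among these too but carry no neighbour. *)
Lemma inner_degree_le v : a < v < b ->
  \sum_(a <= j < b.+1) g v j + same v <= minn T (v - a) + minn T (b - v).
Proof.
move=> /andP[av vb]; rewrite -sum_near_left -sum_near_right -big_split /=.
have vb1 : v < b.+1 by lia.
rewrite (big_cat_nat (n := v)) //=; [|lia..].
have gvv : g v v = false by apply: contraTF isT => /g_col; rewrite eqxx.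
rewrite [X in _ + X <= _]big_ltn // gvv eqxx !andbF add0n.
have near j d : a <= j <= b -> j != v -> j + d = v \/ v + d = j ->
    g v j + [&& v <= a + T, a < j <= a + T, j != v & c j == c v] <= (d <= T).
  move=> jab jv dE; case gvj: (g v j).
    have /negbTE := g_col gvj; rewrite eq_sym => ->; rewrite !andbF addn0.
    rewrite lt0b leqNgt; apply/negP => far.
    have [ltvj|ltjv] : v < j \/ j < v by lia.
      by have := short gvj; lia.
    by move: gvj; rewrite g_sym => /short; lia.
  by case: andP => // -[vT /andP[jT _]]; rewrite lt0b; lia.
apply: leq_add; rewrite big_nat_cond [leqRHS]big_nat_cond; apply: leq_sum => j;
  rewrite andbT => /andP[lej ltj]; apply: near; clear -av vb lej ltj; lia.
Qed.

Lemma sum_same_ge : T ^ 2 <= 2 * (\sum_(a.+1 <= v < b) same v) + 2 * T.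
Proof.
have := sum_same_color c a.+1 T.
set S := (\sum_(_ <= v < _) \sum_(_ <= j < _) _)%N => ST.
suff : S <= \sum_(a.+1 <= v < b) same v + T by lia.
rewrite [X in _ <= X + _](big_cat_nat (n := a.+1 + T)) /=; [|lia..].
rewrite addnAC; apply: leq_trans (leq_addr _ _).
rewrite -{2}[T](addKn a.+1) -[X in _ + X]muln1 -sum_nat_const_nat -big_split /=.
rewrite /S big_nat_cond [leqRHS]big_nat_cond; apply: leq_sum => v.
rewrite andbT => v_in; rewrite /same.
rewrite [X in _ <= X + _](big_cat_nat (n := a.+1)) /=; [|lia..].
rewrite [X in _ <= _ + X + _](big_cat_nat (n := a.+1 + T)) /=; [|lia..].
(* The term [2 * T] of the statement pays for the diagonal pairs [j = v]. *)
have -> : 1 = \sum_(a.+1 <= j < a.+1 + T) (j == v) :> nat.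
  rewrite (bigD1_seq v) ?iota_uniq ?mem_index_iota //= eqxx big1 //.
  by move=> j /negbTE ->.
rewrite addnA addnAC; apply: leq_trans (leq_addr _ _).
rewrite -addnA; apply: leq_trans (leq_addl _ _).
rewrite -big_split /= big_nat_cond [leqRHS]big_nat_cond; apply: leq_sum => j.
rewrite andbT => j_in.
have -> : v <= a + T by clear -v_in; lia.
have -> : a < j <= a + T by clear -j_in; lia.
by case: eqP; case: eqP.
Qed.

(** Each inner vertex has degree at least [2 * T + 2], so the bounds above on
    its degree inside [[a, b]] leave at least
    [2 * T + T * (T - 1) + (T ^ 2 / 2 - T) = 3 / 2 * T ^ 2] edges going out. *)
Lemma leaving_edges_ge :
  (forall i, i < n -> 2 * T + 2 <= \sum_(0 <= j < n) g i j) ->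
  3 * T ^ 2 <=
    2 * \sum_(a.+1 <= v < b) \sum_(0 <= j < n | ~~ (a <= j <= b)) g v j.
Proof.
move=> deg; set out := (\sum_(a.+1 <= v < b) _)%N.
pose m := b - a.+1.
pose inn := \sum_(a.+1 <= v < b) \sum_(a <= j < b.+1) g v j.
have degs : (2 * T + 2) * m <= out + inn.
  rewrite /out /inn -big_split /= mulnC -sum_nat_const_nat.
  rewrite big_nat_cond [leqRHS]big_nat_cond; apply: leq_sum => v.
  rewrite andbT => v_in; apply: leq_trans (deg v _) _; first by lia.
  rewrite (bigID (fun j => a <= j <= b)) /= addnC leq_add2l.
  rewrite (big_cat_nat (n := a)) //=; last by lia.
  rewrite (big_cat_nat (n := b.+1) (p := n)) //=; last by lia.
  rewrite big_nat_cond big1 ?add0n; last by move=> j; lia.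
  rewrite addnC big_nat_cond big1 ?add0n; last by move=> j; lia.
  by rewrite [leqRHS](bigID (fun j => a <= j <= b)) leq_addr.
have inn_le : inn + \sum_(a.+1 <= v < b) same v <=
    2 * \sum_(1 <= i < m.+1) minn T i.
  (* The contributions of the two ends agree after reversing the interval. *)
  have lE : \sum_(1 <= i < m.+1) minn T i = \sum_(a.+1 <= v < b) minn T (v - a).
    rewrite -(add1n a) (big_addn 1 b a).
    have -> : b - a = m.+1 by rewrite /m; lia.
    by apply: eq_bigr => i _; rewrite addnK.
  have rE : \sum_(a.+1 <= v < b) minn T (v - a) =
      \sum_(a.+1 <= v < b) minn T (b - v).
    rewrite [RHS]big_nat_rev /=; apply: eq_big_nat => v v_in; congr minn; lia.
  rewrite lE mul2n -addnn {2}rE -!big_split /=.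
  rewrite big_nat_cond [leqRHS]big_nat_cond; apply: leq_sum => v.
  by rewrite andbT => v_in; apply: inner_degree_le.
have Tm : T <= m by rewrite /m; lia.
have := sum_minn Tm; have := sum_same_ge.
move: (\sum_(a.+1 <= v < b) same v) inn_le => sm.
move: (\sum_(1 <= i < m.+1) minn T i) => mn; nia.
Qed.

End ShortestLongEdge.

(** * Angular order of points in convex position *)

Section Orientation.

Local Open Scope ring_scope.

Variables (R : realType) (V : finType) (p : V -> 'rV[R]_2).
Implicit Types x y z w : V.

(** Twice the signed area of the triangle [p x], [p y], [p z]. *)
Definition orient x y z : R :=
  (p y 0 0 - p x 0 0) * (p z 0 1 - p x 0 1)
  - (p y 0 1 - p x 0 1) * (p z 0 0 - p x 0 0).

Lemma orient_rot x y z : orient y z x = orient x y z.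
Proof. by rewrite /orient; ring. Qed.

Lemma orientC x y z : orient y x z = - orient x y z.
Proof. by rewrite /orient; ring. Qed.

Lemma orient_swap x y z : orient x z y = - orient x y z.
Proof. by rewrite /orient; ring. Qed.

(** The two ways to cut a quadrilateral along a diagonal. *)
Lemma orient_split x y z w :
  orient x y z + orient x z w = orient y z w + orient x y w.
Proof. by rewrite /orient; ring. Qed.

Lemma rV2P (u v : 'rV[R]_2) : u 0 0 = v 0 0 -> u 0 1 = v 0 1 -> u = v.
Proof.
move=> uv0 uv1; apply/rowP => i; case: (unliftP 0 i) => [j|] -> //.
by rewrite (_ : lift 0 j = 1) //; apply/val_inj; rewrite /= ord1.
Qed.

Hypothesis pP : convex_position p.

Lemma orient_neq0 x y z : x != y -> y != z -> x != z -> orient x y z != 0.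
Proof.
case: pP => p_inj p_ncol _ xy yz xz; apply/eqP => o0.
apply: (p_ncol x y z xy yz xz); exists (p x), (p y - p x); split.
  by rewrite subr_eq0 eq_sym (inj_eq p_inj).
move=> u; rewrite !inE => /or3P[] /eqP ->.
- by exists 0; rewrite scale0r addr0.
- by exists 1; rewrite scale1r addrC subrK.
have solve (a b d d' : R) : d != 0 -> d * b = d' * a -> b = a / d * d'.
  by move=> d0 db; rewrite mulrAC [a * d']mulrC -db mulrAC mulfV ?mul1r.
have : (p y - p x) 0 0 != 0 \/ (p y - p x) 0 1 != 0.
  apply/orP; rewrite -negb_and; apply: contra xy => /andP[/eqP d0 /eqP d1].
  rewrite eq_sym -(inj_eq p_inj) -subr_eq0; apply/eqP.
  by apply: rV2P; rewrite ?d0 ?d1 mxE.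
move/subr0_eq: o0 => o0; rewrite !mxE => -[] d0.
- exists ((p z 0 0 - p x 0 0) / (p y 0 0 - p x 0 0)).
  apply: rV2P; rewrite !mxE; first by field.
  by rewrite -(solve _ _ _ _ d0 o0) addrC subrK.
- exists ((p z 0 1 - p x 0 1) / (p y 0 1 - p x 0 1)).
  apply: rV2P; rewrite !mxE; last by field.
  by rewrite -(solve _ _ _ _ d0 (esym o0)) addrC subrK.
Qed.

(** Three positive orientations put [w] inside the triangle [x y z], with the
    areas as barycentric coordinates, so [w] would not be extreme. *)
Lemma not_in_triangle x y z w : w != x -> w != y -> w != z ->
  ~ [/\ 0 < orient w x y, 0 < orient w y z & 0 < orient w z x].
Proof.
move=> wx wy wz [oxy oyz ozx]; case: pP => _ _ /(_ w); apply.
pose D := orient w x y + orient w y z + orient w z x.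
have D0 : D != 0 by rewrite /D; lra.
pose al u : R := orient w y z / D * (u == x)%:R + orient w z x / D * (u == y)%:R
  + orient w x y / D * (u == z)%:R.
have sum_ind (A : lmodType R) (F : V -> A) v : w != v ->
    \sum_(u in [set~ w]) (u == v)%:R *: F u = F v.
  move=> wv; rewrite (bigD1 v) /= ?inE 1?eq_sym // eqxx scale1r big1 ?addr0 //.
  by move=> u /andP[_ /negbTE ->]; rewrite scale0r.
have sum_al (A : lmodType R) (F : V -> A) : \sum_(u in [set~ w]) al u *: F u =
    (orient w y z / D) *: F x + (orient w z x / D) *: F y
    + (orient w x y / D) *: F z.
  rewrite -(sum_ind _ F x) // -(sum_ind _ F y) // -(sum_ind _ F z) //.
  rewrite !scaler_sumr -!big_split; apply: eq_bigr => u _ /=.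
  by rewrite /al !scalerDl !scalerA.
exists al; split.
- by move=> u; rewrite /al !addr_ge0 // mulr_ge0 // divr_ge0 /D; lra.
- rewrite (eq_bigr (fun u => al u *: (1 : R^o))) => [|u _]; last first.
    by rewrite /GRing.scale /= mulr1.
  by rewrite (sum_al R^o (fun=> 1)) /GRing.scale /= /D; field.
- rewrite sum_al; apply: rV2P; rewrite !mxE; move: D0; rewrite /D /orient => D0;
    by field.
Qed.

(** The four hypotheses say that [w x y z] is a counterclockwise convex
    quadrilateral.  Each diagonal is cut in the ratio of the areas of the two
    triangles that it separates, which gives the parameters [t] and [s]. *)
Lemma cross_of_orient w x y z :
  0 < orient w x y -> 0 < orient w x z -> 0 < orient w y z ->
  0 < orient x y z -> cross p [set w; y] [set x; z].
Proof.
move=> wxy wxz wyz xyz.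
pose D := orient w x z + orient x y z.
have D_gt0 : 0 < D by rewrite /D; lra.
have DE : D = orient w x y + orient w y z by rewrite /D addrC -orient_split.
pose t := orient w x z / D; pose s := orient w x y / D.
exists ((1 - t) *: p w + t *: p y); split.
  exists w, y, t; split=> //; rewrite /t divr_gt0 //= ltr_pdivrMr // /D; lra.
exists x, z, s; split=> //.
  by rewrite /s divr_gt0 //= ltr_pdivrMr // DE; lra.
have D0 : D != 0 by rewrite gt_eqF.
by apply: rV2P; rewrite !mxE /t /s; move: D0; rewrite /D /orient => D0; field.
Qed.

(** Otherwise [v] would lie inside the triangle [x y z]: seen from an extreme
    point, all other points fit in a half plane, where angles are ordered
    linearly. *)
Lemma orient_trans v x y z : x != v -> y != v -> z != v ->
  0 < orient v x y -> 0 < orient v y z -> 0 < orient v x z.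
Proof.
move=> xv yv zv oxy oyz.
have xz : x != z by apply: contraTneq oyz => <-; rewrite orient_swap; lra.
have := @orient_neq0 v x z; rewrite xz !(eq_sym v) xv zv => /(_ isT isT isT).
rewrite neq_lt => /orP[oxz|//]; exfalso.
apply: (@not_in_triangle x y z v); rewrite 1?eq_sym //; split=> //.
by rewrite orient_swap; lra.
Qed.

(** Otherwise [y] would lie inside the triangle [v x z]. *)
Lemma orient_gt0 v x y z : x != v -> y != v -> z != v -> x != y -> y != z ->
  0 < orient v x y -> 0 < orient v y z -> 0 < orient x y z.
Proof.
move=> xv yv zv xy yz oxy oyz.
have oxz := orient_trans xv yv zv oxy oyz.
have xz : x != z by apply: contraTneq oxz => ->; rewrite /orient; lra.
have := orient_neq0 xy yz xz; rewrite neq_lt => /orP[oxyz|//]; exfalso.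
apply: (@not_in_triangle v x z y) => //; first by rewrite eq_sym.
rewrite -(orient_rot y v x) (orient_rot v y z) (orientC x y z).
by rewrite oxy oyz oppr_gt0.
Qed.

(** Counterclockwise order along the hull, cut open at [v], which becomes the
    least element. *)
Definition angular_le v x y :=
  (x == y) || (x == v) || (y != v) && (0 < orient v x y).

Lemma angular_le_total v : total (angular_le v).
Proof.
move=> x y; rewrite /angular_le.
have [//|xy] := eqVneq x y; have [//|xv] := eqVneq x v.
have [|yv] := eqVneq y v; rewrite ?orbT //=.
have := @orient_neq0 v x y; rewrite xy !(eq_sym v) xv yv => /(_ isT isT isT).
by rewrite neq_lt orbC (orient_swap v x y) oppr_gt0.
Qed.

Lemma angular_le_anti v : antisymmetric (angular_le v).
Proof.
move=> x y; rewrite /angular_le.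
have [//|xy] /= := eqVneq x y.
have [->|xv] := eqVneq x v; rewrite /= ?[v == y]eq_sym.
  by rewrite orbF => /eqP.
have [->|yv] := eqVneq y v => //=.
rewrite (orient_swap v x y) oppr_gt0 => /andP[/lt_trans gt0 /gt0].
by rewrite ltxx.
Qed.

Lemma angular_le_trans v : transitive (angular_le v).
Proof.
move=> y x z; rewrite /angular_le.
have [<-//|xy] := eqVneq x y; have [_|xv] := eqVneq x v; rewrite ?orbT //=.
have [->//|yv] := eqVneq y v => /= oxy.
have [<-|yz] := eqVneq y z; first by rewrite yv oxy orbT.
by move=> /= /andP[zv oyz]; rewrite zv (orient_trans xv yv zv oxy oyz) orbT.
Qed.

Definition angular_lt v x y := (x != y) && angular_le v x y.

Lemma orient_angular_lt v x y z :
  angular_lt v x y -> angular_lt v y z -> 0 < orient x y z.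
Proof.
rewrite /angular_lt /angular_le => /andP[xy +] /andP[yz].
rewrite (negbTE xy) (negbTE yz) /=.
have [xv|xv] := eqVneq x v => /=.
  by rewrite -xv eq_sym (negbTE xy) => _ /andP[].
move=> /andP[yv oxy]; rewrite (negbTE yv) => /andP[zv oyz].
exact: (orient_gt0 xv yv zv xy yz oxy oyz).
Qed.

Lemma cross_angular_lt v w x y z :
  angular_lt v w x -> angular_lt v x y -> angular_lt v y z ->
  cross p [set w; y] [set x; z].
Proof.
have lt_trans : transitive (angular_lt v).
  move=> b a d /andP[ab leab] /andP[bd lebd].
  rewrite /angular_lt (angular_le_trans leab lebd) andbT.
  by apply: contraNneq ab => ad; apply/eqP/(@angular_le_anti v); rewrite leab ad.
move=> wx xy yz; have wy := lt_trans _ _ _ wx xy; have xz := lt_trans _ _ _ xy yz.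
by apply: cross_of_orient;
  [apply: orient_angular_lt xy | apply: orient_angular_lt xz
  |apply: orient_angular_lt yz | apply: orient_angular_lt yz].
Qed.

End Orientation.

(** * A subgraph of large minimum degree *)

Section Graph.

Variables (V : finType) (e : rel V).
Hypothesis e_simple : simple_graph e.

Lemma mem_edges x y : ([set x; y] \in edges e) = e x y.
Proof.
apply/imset2P/idP => [[u v _]|exy]; last by exists x y; rewrite ?inE.
rewrite !inE /= => euv /setP xyE.
have [e_sym e_irr] := e_simple.
have uv : u != v by apply: contraTneq euv => ->; rewrite e_irr.
have := xyE u; have := xyE v; rewrite !inE !eqxx orbT /=.
rewrite ![_ == x]eq_sym ![_ == y]eq_sym.
move=> /orP[]/eqP xv /orP[]/eqP xu; subst.
- by rewrite eqxx in uv.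
- by rewrite e_sym.
- by [].
- by rewrite eqxx in uv.
Qed.

(** For a smallest [S] spanning more than [D * #|S|] edges, deleting a vertex
    of degree at most [D] would leave a smaller such set. *)
Lemma dense_subgraph D :
  D * #|V| < #|edges e| ->
  exists2 S : {set V}, 0 < #|S| &
    forall x, x \in S -> D < #|[set u in S | e x u]|.
Proof.
move=> dense; pose E (S : {set V}) := [set f in edges e | f \subset S].
have denseT : D * #|[set: V]| < #|E [set: V]|.
  rewrite cardsT (leq_trans dense) // subset_leq_card //.
  by apply/subsetP => f fe; rewrite inE fe subsetT.
have [S densS minS] := @arg_minnP _ [set: V] (fun S => D * #|S| < #|E S|)
  (fun S : {set V} => #|S|) denseT.
exists S.
  rewrite lt0n; apply: contraTneq densS => /cards0_eq ->; rewrite -leqNgt.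
  apply: leq_trans (leq0n _); rewrite leqn0 cards_eq0.
  apply/eqP/setP => f; rewrite !inE subset0; apply/negP => /andP[+ /eqP f0].
  by rewrite f0 => /imset2P[x y _ _] /setP /(_ x); rewrite !inE eqxx.
move=> x xS; rewrite ltnNge; apply/negP => degx.
have S1 : #|S| = #|S :\ x|.+1 by rewrite (cardsD1 x S) xS.
suff : D * #|S :\ x| < #|E (S :\ x)| by move=> /minS; rewrite S1 ltnn.
suff ES : #|E S| <= #|E (S :\ x)| + D.
  move: densS; rewrite S1 mulnS => /leq_trans /(_ ES).
  by rewrite addnC -addSn leq_add2r.
have sub : E S \subset
    E (S :\ x) :|: [set [set x; u] | u in [set u in S | e x u]].
  apply/subsetP => f; rewrite !inE => /andP[fe fS]; rewrite fe subsetD1 fS /=.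
  have [xf|//] := boolP (x \in f); apply/imsetP.
  have /imset2P[u v _ _ fE] := fe; move: fe fS xf; rewrite fE mem_edges => euv.
  rewrite subUset !sub1set => /andP[uS vS]; rewrite !inE => /orP[]/eqP ->.
    by exists v; rewrite // inE vS.
  by exists u; [rewrite inE uS /=; case: e_simple => -> | exact: setUC].
apply: leq_trans (subset_leq_card sub) _.
apply: leq_trans (leq_card_setU _ _) _; rewrite leq_add2l.
exact: leq_trans (leq_imset_card _ _) degx.
Qed.

End Graph.

(** * Crossings of the shortest long edge *)

Section CrossingCount.

Variables (R : realType) (V : finType) (e : rel V) (p : V -> 'rV[R]_2).
Hypotheses (e_simple : simple_graph e) (e_bip : bipartite e).
Hypothesis pP : convex_position p.

(** The vertices of [S] are renamed by their rank along the hull, which turns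
    the induced graph into a graph on an interval of integers.  An edge from
    inside [(a, b)] to outside [[a, b]] interleaves with [ab], hence crosses
    it. *)
Lemma heavily_crossed_edge (S : {set V}) T :
  0 < #|S| ->
  (forall x, x \in S -> 2 * T + 2 <= #|[set u in S | e x u]|) ->
  exists2 f, f \in edges e &
    3 * T ^ 2 <= 2 * #|[set g in edges e | (g != f) && `[< cross p f g >]]%SET|.
Proof.
move=> /card_gt0P[v0 v0S] degS; have [e_sym e_irr] := e_simple.
have [c cP] := e_bip; have leT := angular_le_total pP v0.
pose s := sort (angular_le p v0) (enum S); pose n := size s.
have permS : perm_eq s (enum S) by rewrite /s perm_sort.
have memS x : (x \in s) = (x \in S) by rewrite (perm_mem permS) mem_enum.
have uniqS : uniq s by rewrite (perm_uniq permS) enum_uniq.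
pose x_ i := nth v0 s i.
have x_eq i j : i < n -> j < n -> (x_ i == x_ j) = (i == j).
  by move=> iN jN; rewrite nth_uniq.
have x_lt i j : i < j < n -> angular_lt p v0 (x_ i) (x_ j).
  move=> /andP[ij jn]; rewrite /angular_lt x_eq // ?(ltn_trans ij) // ltn_eqF //=.
  apply: (sorted_ltn_nth (angular_le_trans pP (v:=v0))) => //.
    exact: sort_sorted.
  by rewrite inE (ltn_trans ij).
pose g i j := [&& i < n, j < n & e (x_ i) (x_ j)].
have g_sym : symmetric g by move=> i j; rewrite /g e_sym andbCA.
have g_col i j : g i j -> c (x_ i) != c (x_ j) by case/and3P => _ _ /cP.
have deg_g i : i < n -> 2 * T + 2 <= \sum_(0 <= j < n) g i j.
  move=> iN; have xiS : x_ i \in S by rewrite -memS mem_nth.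
  apply: leq_trans (degS _ xiS) _; rewrite -sum1dep_card.
  rewrite (eq_bigl (fun u => (u \in S) && e (x_ i) u)) //.
  rewrite big_mkcondr -big_enum -(perm_big _ permS) /= (big_nth v0).
  rewrite big_nat_cond [leqRHS]big_nat_cond.
  apply: leq_sum => j /andP[/andP[_ jn] _].
  by rewrite /g iN jn; case: (e _ _).
have n_gt0 : 0 < n.
  by rewrite /n lt0n size_eq0; apply: contraTneq v0S => s0; rewrite -memS s0.
have deg0 : T < \sum_(0 <= j < n) g 0 j by apply: leq_trans (deg_g 0 n_gt0); lia.
have g_lt i j : g i j -> i < n by case/andP.
have [a [b [gab abT bn short]]] :=
  exists_shortest_long_edge g_sym g_col g_lt n_gt0 deg0.
have [an _ eab] := and3P gab.
exists [set x_ a; x_ b]; first by rewrite mem_edges.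
apply: leq_trans (leaving_edges_ge g_sym g_col abT bn short deg_g) _.
rewrite leq_mul2l /=.
(* The leaving edges, as pairs (inner end, outer end); the ends of an edge can
   be told apart, so distinct pairs give distinct edges. *)
pose P (z : 'I_n * 'I_n) := [&& a < z.1 < b, ~~ (a <= z.2 <= b) & g z.1 z.2].
pose F (z : 'I_n * 'I_n) := [set x_ z.1; x_ z.2].
have -> : \sum_(a.+1 <= v < b) \sum_(0 <= j < n | ~~ (a <= j <= b)) g v j =
    #|[set F z | z in P]|.
  rewrite card_in_imset.
    rewrite -sum1_card (eq_bigl (fun z : 'I_n * 'I_n =>
      (a < z.1 < b) && ~~ (a <= z.2 <= b) && g z.1 z.2)); last first.
      by move=> z; rewrite unfold_in /P andbA.
    rewrite big_mkcondr /=.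
    rewrite -(pair_big (fun i : 'I_n => a < i < b)
      (fun j : 'I_n => ~~ (a <= j <= b)) (fun i j => if g i j then 1 else 0)) /=.
    rewrite (big_nat_widenl _ 0) // (big_nat_widen _ _ n) ?big_mkord; last by lia.
    apply: eq_big => [i|i _]; first by [].
    by rewrite big_mkord; apply: eq_bigr => j _; case: (g i j).
  move=> [i j] [i' j']; rewrite !unfold_in /P /F /=.
  move=> /and3P[iab jab _] /and3P[iab' jab' _].
  move=> /setP xE.
  have := xE (x_ i); have := xE (x_ j); rewrite !inE !x_eq // !eqxx orbT /=.
  move=> jE iE; have [ii' jj'] : i = i' :> nat /\ j = j' :> nat by lia.
  by congr pair; apply: val_inj.
apply/subset_leq_card/subsetP => _ /imsetP[[i j] ijP ->].
have /and3P[/= iab jab /and3P[_ _ eij]] : P (i, j) by [].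
rewrite inE mem_edges // eij /=; apply/andP; split.
  apply/eqP => /setP /(_ (x_ i)); rewrite !inE eqxx /= !x_eq //; lia.
apply/asboolP.
have [ja|bj] : j < a \/ b < j by lia.
  have := cross_angular_lt pP (x_lt j a _) (x_lt a i _) (x_lt i b _).
  move=> /(_ ltac:(lia) ltac:(lia) ltac:(lia)) [z []]; rewrite setUC => ? ?.
  by exists z.
have := cross_angular_lt pP (x_lt a i _) (x_lt i b _) (x_lt b j _).
have jn := ltn_ord j; by move=> /(_ ltac:(lia) ltac:(lia) ltac:(lia)).
Qed.

Lemma edges_le k T : k_plane k e p -> 2 * k < 3 * T ^ 2 ->
  #|edges e| <= (2 * T + 1) * #|V|.
Proof.
move=> kP kT; rewrite leqNgt; apply/negP => /dense_subgraph.
move=> /(_ e_simple) [S S0 degS].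
have degS2 x : x \in S -> 2 * T + 2 <= #|[set u in S | e x u]|.
  by move=> /degS; rewrite addn1 addn2.
have [f fe] := heavily_crossed_edge S0 degS2.
by have := kP f fe; lia.
Qed.

End CrossingCount.

Local Open Scope ring_scope.

Theorem corollary24 (R : realType) :
  exists k0 : nat, forall k : nat, (k0 <= k)%N ->
  forall (V : finType) (e : rel V),
    simple_graph e -> bipartite e -> outer_k_planar R k e ->
    (#|edges e|%:R : R) <=
      2 * Num.sqrt (8 / 11) * Num.sqrt k%:R * #|V|%:R.
Proof.
exists 4500%N => k k_ge V e e_simple e_bip [p [pP kP]].
have [T kT Tmin] : exists2 T : nat, (2 * k < 3 * T ^ 2)%N &
    forall m, (2 * k < 3 * m ^ 2)%N -> (T <= m)%N.
  have : exists T, (2 * k < 3 * T ^ 2)%N by exists k; nia.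
  by case/ex_minnP => T; exists T.
have T_gt0 : (0 < T)%N by case: T kT {Tmin}.
have T1 : (3 * T.-1 ^ 2 <= 2 * k)%N.
  by rewrite leqNgt; apply/negP => /Tmin; lia.
have Tk : (11 * (2 * T + 1) ^ 2 <= 32 * k)%N.
  have TE : T = T.-1.+1 by rewrite prednK.
  rewrite TE; move: (T.-1) T1 => x; rewrite -!mulnn; clear -k_ge => xk.
  (* The gap between [2 / 3] and [8 / 11] leaves room for a multiple of [k];
     this linear bound makes it absorb the terms of degree at most one in [x].
     For [x <= 60] it is the constant [4500] that gives it. *)
  have : (66 * x + 66 <= k)%N by have [|] := leqP x 60; nia.
  nia.
have := edges_le e_simple e_bip pP kP kT.
rewrite -(ler_nat R) natrM => /le_trans; apply; apply: ler_wpM2r => //.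
rewrite -mulrA -sqrtrM; last by lra.
rewrite -ler_sqr ?nnegrE ?mulr_ge0 ?sqrtr_ge0 // exprMn sqr_sqrtr; last first.
  by rewrite mulr_ge0 //; lra.
have : ((11 * (2 * T + 1) ^ 2)%:R : R) <= (32 * k)%:R by rewrite ler_nat.
by rewrite !natrM; lra.
Qed.
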